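(* Let $0<q<1$. The function $f(x)=\big(\Gamma_q(x+1)\big)^{\frac{1}{x}}$ is strictly log-concave and strictly increasing on $(0,\infty)$.
   Context: For $0<q<1$ and complex $a$, $(a;q)_\infty=\prod_{i=0}^{\infty}(1-aq^i)$. For real $x>0$, the $q$-gamma function is $\Gamma_q(x)=\frac{(q;q)_\infty}{(q^x;q)_\infty}(1-q)^{1-x}$. A positive function is strictly log-concave if its logarithm is strictly concave. *)

(* Defs.v *)
From mathcomp Require Import all_boot all_order all_algebra.
From mathcomp Require Import all_classical all_reals all_analysis.

Set Implicit Arguments.
Unset Strict Implicit.
Unset Printing Implicit Defensive.

Import Order.TTheory GRing.Theory Num.Theory.
Import numFieldNormedType.Exports.

Local Open Scope classical_set_scope.
Local Open Scope ring_scope.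

(* The infinite product (a; q)_oo, as the limit of its partial products. K is
   meant to be the real or complex field, where the limit exists if |q| < 1. *)
Definition qpochhammer (K : numFieldType) (a q : K) : K :=
  lim ((fun n : nat => \prod_(i < n) (1 - a * q ^+ i)) @ \oo).

Definition qgamma (R : realType) (q x : R) : R :=
  qpochhammer q q / qpochhammer (q `^ x) q * (1 - q) `^ (1 - x).

Definition strictly_concave (R : realType) (I : interval R) (f : R -> R) :=
  forall x y t : R, x \in I -> y \in I -> x != y -> 0 < t < 1 ->
    t * f x + (1 - t) * f y < f (t * x + (1 - t) * y).

(* Positivity is part of the definition: ln is 0 outside of the positive
   reals. *)
Definition strictly_log_concave (R : realType) (I : interval R) (f : R -> R) :=
  {in I, forall x, 0 < f x} /\ strictly_concave I (fun x => ln (f x)).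

Definition strictly_increasing (R : realType) (I : interval R) (f : R -> R) :=
  {in I &, {homo f : x y / x < y}}.

(* Main.v *)
Require Import Defs.
From mathcomp Require Import all_boot all_order all_algebra.
From mathcomp Require Import all_classical all_reals all_analysis.
From mathcomp Require Import ring lra.

Import Order.TTheory GRing.Theory Num.Theory.
Import numFieldNormedType.Exports.

Set Implicit Arguments.
Unset Strict Implicit.
Unset Printing Implicit Defensive.

Local Open Scope ring_scope.

(** The idea is that the logarithm of f is, up to a constant, a sum of slopes of
    chords, taken from the origin, of very explicit functions: with
    p_i(x) = - ln (1 - q^(x+i+1)),
      ln f(x) = - ln (1 - q) + \sum_(i >= 0) (p_i(x) - p_i(0)) / x,
    because the factor (1 - q)^(1 - (x + 1)) contributes - x ln (1 - q), and
    (q; q)_oo is the value at x = 0 of (q^(x+1); q)_oo; this is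
    [cvg_slope_ln_qgamma].  So it suffices to study one summand, the chord
    slope s(x) = (p(x) - p(0)) / x of p = p_i.

    Heuristically s(x) is the integral of p'(t x) over t in [0, 1], so that s
    is increasing when p'' > 0 and concave when p''' < 0.  The proof
    differentiates instead of integrating.  One has s' = M / x^2 with
    M = x p' - (p - p(0)), M(0) = 0 and M' = x p'', and s'' = - N / x^3 with
    N = 2 M - x^2 p'', N(0) = 0 and N' = - x^2 p''' ([slope0_increasing] and
    [slope0_strictly_concave]).  For p_i both sign conditions can be read off
    the derivatives: with u = q^(x+i+1) and b = ln q < 0, so that u' = b u,
      p' = b u / (1 - u), p'' = b^2 u / (1 - u)^2 > 0 and
      p''' = b^3 u (1 + u) / (1 - u)^3 < 0.

    Strictness survives the infinite sum because all terms of the sum of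
    defects are positive, so that the limit is at least the first of them
    ([increasing_series] and [strictly_concave_series]). *)

(** * Calculus on the positive half-line *)

Lemma mean_value (R : realType) (f df : R -> R) (a b : R) : a < b ->
    (forall x : R, a <= x <= b -> is_derive x 1 f (df x)) ->
  exists2 c, a < c < b & f b - f a = df c * (b - a).
Proof.
move=> ab fdf.
have [||c cab ->] := @MVT R f df a b ab.
- by move=> x; rewrite in_itv /= => /andP[ax xb]; apply: fdf; rewrite !ltW.
- apply: derivable_within_continuous => x; rewrite in_itv /= => axb.
  exact: (@ex_derive _ _ _ _ _ _ _ (fdf x axb)).
by exists c => //; rewrite in_itv /= in cab.
Qed.

Lemma lt_pos_derive (R : realType) (f df : R -> R) (a b : R) : a < b ->
    (forall x : R, a <= x <= b -> is_derive x 1 f (df x)) ->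
    (forall x : R, a < x < b -> 0 < df x) ->
  f a < f b.
Proof.
move=> ab fdf df0; have [c cab e] := mean_value ab fdf.
by rewrite -subr_gt0 e mulr_gt0 ?subr_gt0 // df0.
Qed.

(** With z = t x + (1 - t) y, the mean value theorem on [x, z] and on [z, y]
    writes the concavity defect at z as t (1 - t) (y - x) times the difference
    of two values of the derivative. *)
Lemma strictly_concave_derive (R : realType) (f df : R -> R) :
    (forall x : R, 0 < x -> is_derive x 1 f (df x)) ->
    (forall x y : R, 0 < x -> x < y -> df y < df x) ->
  strictly_concave `]0, +oo[ f.
Proof.
move=> fdf dfd x y t.
wlog : x y t / x < y.
  move=> wl x0 y0 xy t01; have [lt|gt|e] := ltgtP x y.
  - exact: wl.
  - have := wl y x (1 - t) gt y0 x0.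
    rewrite eq_sym subKr => /(_ xy) wl'.
    rewrite addrC [t * x + _]addrC; apply: wl'.
    by case/andP: t01 => t0 t1; rewrite subr_gt0 t1 ltrBlDr ltrDl.
  - by rewrite e eqxx in xy.
move=> xy; rewrite !in_itv /= !andbT => x0 y0 _ /andP[t0 t1].
set z := t * x + (1 - t) * y.
have zx : z - x = (1 - t) * (y - x) by rewrite /z; ring.
have yz : y - z = t * (y - x) by rewrite /z; ring.
have xz : x < z by rewrite -subr_gt0 zx mulr_gt0 ?subr_gt0.
have zy : z < y by rewrite -subr_gt0 yz mulr_gt0 ?subr_gt0.
have [|c /andP[xc cz] ec] := @mean_value R f df x z xz.
  by move=> u /andP[xu _]; apply: fdf; apply: lt_le_trans xu.
have [|d /andP[zd dy] ed] := @mean_value R f df z y zy.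
  move=> u /andP[zu _]; apply: fdf.
  by apply: lt_le_trans zu; apply: lt_trans xz.
have cd : df d < df c by apply: dfd; [exact: lt_trans xc | exact: lt_trans zd].
rewrite -subr_gt0.
have -> : f z - (t * f x + (1 - t) * f y) =
  t * (1 - t) * (y - x) * (df c - df d).
  transitivity (t * (f z - f x) - (1 - t) * (f y - f z)); first by ring.
  by rewrite ec ed zx yz; ring.
by rewrite !mulr_gt0 ?subr_gt0.
Qed.

(** * Slopes of chords from the origin *)

Definition slope0 (R : realType) (p : R -> R) (x : R) : R := (p x - p 0) / x.

Section Slope.
Variables (R : realType) (p p1 p2 p3 : R -> R).
Hypothesis dp : forall x : R, 0 <= x -> is_derive x 1 p (p1 x).
Hypothesis dp1 : forall x : R, 0 <= x -> is_derive x 1 p1 (p2 x).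

Let M (x : R) := x * p1 x - (p x - p 0).

Lemma is_derive_slope0 (x : R) : 0 < x ->
  is_derive x 1 (slope0 p) (M x / x ^+ 2).
Proof.
move=> x0.
have Dp := dp (ltW x0).
have x0' : x != 0 by rewrite gt_eqF.
have Dv := is_deriveV x0' (is_derive_id x 1).
apply: is_derive_eq.
rewrite /M /GRing.scale /=.
field.
by [].
Qed.

Let is_derive_M (x : R) : 0 <= x -> is_derive x 1 M (x * p2 x).
Proof.
move=> x0.
have Dp := dp x0.
have Dp1 := dp1 x0.
apply: is_derive_eq.
rewrite /GRing.scale /=.
ring.
Qed.

(** A convex function has increasing slopes: M vanishes at 0 and M' = x p''. *)
Lemma slope0_increasing : (forall x : R, 0 < x -> 0 < p2 x) ->
  strictly_increasing `]0, +oo[ (slope0 p).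
Proof.
move=> p2_gt0 x y; rewrite !in_itv /= !andbT => x0 y0 xy.
apply: (@lt_pos_derive _ _ (fun x => M x / x ^+ 2)) => // u /andP[xu _].
  by apply: is_derive_slope0; apply: lt_le_trans xu.
have u0 : 0 < u by apply: lt_trans xu.
rewrite divr_gt0 ?exprn_gt0 //.
have -> : 0 = M 0 by rewrite /M mul0r !subrr.
apply: (@lt_pos_derive _ _ (fun x => x * p2 x)) => // v /andP[v0 _].
  exact: is_derive_M.
by rewrite mulr_gt0 ?p2_gt0.
Qed.

Hypothesis dp2 : forall x : R, 0 <= x -> is_derive x 1 p2 (p3 x).

(** A negative third derivative makes the slope concave: the divided
    differences of order two of the slope are divided differences of order
    three of p. *)
Lemma slope0_strictly_concave : (forall x : R, 0 < x -> p3 x < 0) ->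
  strictly_concave `]0, +oo[ (slope0 p).
Proof.
move=> p3_lt0.
apply: (strictly_concave_derive is_derive_slope0) => x y x0 xy.
rewrite -ltrN2.
(* N / u^3 is the derivative of - M / u^2, and N' = - u^2 p'''. *)
pose N x := 2 * M x - x ^+ 2 * p2 x.
apply: (@lt_pos_derive _ (fun u => - (M u / u ^+ 2)) (fun u => N u / u ^+ 3))
  => // u /andP[xu _].
  have u0 : 0 < u by apply: lt_le_trans xu.
  have DM := is_derive_M (ltW u0).
  have u0' : u ^+ 2 != 0 by rewrite expf_neq0 // gt_eqF.
  have D2 : is_derive u 1 (fun w : R => w ^+ 2) (2 * u).
    by apply: is_derive_eq; rewrite /GRing.scale /=; ring.
  have Dv := is_deriveV (f := fun w : R => w ^+ 2) u0' D2.
  apply: is_derive_eq.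
  rewrite /N /GRing.scale /=.
  field.
  by rewrite gt_eqF.
have u0 : 0 < u by apply: lt_trans xu.
rewrite divr_gt0 ?exprn_gt0 //.
have -> : 0 = N 0 by rewrite /N /M mul0r expr0n /= mul0r !subrr mulr0 subrr.
apply: (@lt_pos_derive _ N (fun x => - (x ^+ 2 * p3 x))) => // v /andP[v0 _].
  have DM := is_derive_M v0.
  have Dp2 := dp2 v0.
  apply: is_derive_eq.
  rewrite /GRing.scale /=.
  ring.
by rewrite oppr_gt0 pmulr_rlt0 ?exprn_gt0 // p3_lt0.
Qed.

End Slope.

(** * One factor of the infinite product *)

Section Factor.
Variables (R : realType) (a b : R).
Hypotheses (a0 : 0 < a) (a1 : a < 1) (b0 : b < 0).

(** With a = q^(i+1) and b = ln q this is minus the logarithm of the i-th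
    factor of (q^(x+1); q)_oo. *)
Definition neglog_factor (x : R) : R := - ln (1 - a * expR (b * x)).

Let u (x : R) := a * expR (b * x).
Let u_gt0 (x : R) : 0 < u x. Proof. by rewrite mulr_gt0 ?expR_gt0. Qed.
Let v_gt0 (x : R) : 0 <= x -> 0 < 1 - u x.
Proof.
move=> x0; rewrite subr_gt0 (le_lt_trans _ a1) // ger_pMr //.
by rewrite -expR0 ler_expR nmulr_rle0.
Qed.

Let du (x : R) : is_derive x 1 u (b * u x).
Proof.
have De : is_derive x 1 (fun y => expR (b * y)) (expR (b * x) * b).
  apply: (is_derive1_comp (f := expR) (g := fun y => b * y)).
  by apply: is_derive_eq; rewrite /GRing.scale /= mulr1.
by apply: is_derive_eq; rewrite /GRing.scale /= /u; ring.
Qed.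

Let dw (x : R) : is_derive x 1 (fun y => 1 - u y) (- (b * u x)).
Proof. by have D := du x; apply: is_derive_eq; rewrite /GRing.scale /=; ring. Qed.

Let dv (x : R) : 0 <= x ->
  is_derive x 1 (fun y => (1 - u y)^-1) (b * u x / (1 - u x) ^+ 2).
Proof.
move=> x0; have v0 : 1 - u x != 0 by rewrite gt_eqF ?v_gt0.
have Dw := dw x.
have D := @is_deriveV R (fun y => 1 - u y) x (- (b * u x)) 1 v0 Dw.
apply: is_derive_eq.
rewrite /GRing.scale /=; field.
by [].
Qed.

Let d0 (x : R) : 0 <= x -> is_derive x 1 neglog_factor (b * (u x / (1 - u x))).
Proof.
move=> x0; have v0 := v_gt0 x0.
have Dw := dw x.
have D := is_derive1_comp (g := fun y : R => 1 - u y) (is_derive1_ln v0) Dw.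
apply: is_derive_eq.
by field; rewrite gt_eqF.
Qed.

Let d1 (x : R) : 0 <= x -> is_derive x 1 (fun x => b * (u x / (1 - u x)))
  (b ^+ 2 * (u x / (1 - u x) ^+ 2)).
Proof.
move=> x0; have v0 := v_gt0 x0; have D := dv x0; have D' := du x.
apply: is_derive_eq.
rewrite /GRing.scale /=.
by field; rewrite gt_eqF.
Qed.

Let d2 (x : R) : 0 <= x ->
  is_derive x 1 (fun x => b ^+ 2 * (u x / (1 - u x) ^+ 2))
  (b ^+ 3 * (u x * (1 + u x) / (1 - u x) ^+ 3)).
Proof.
move=> x0; have v0 := v_gt0 x0; have D := dv x0; have D' := du x.
have -> : (fun x => b ^+ 2 * (u x / (1 - u x) ^+ 2)) =
          (fun x => b ^+ 2 * (u x * ((1 - u x)^-1) ^+ 2)).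
  by apply/funext => y; rewrite exprVn.
apply: is_derive_eq.
rewrite /GRing.scale /=.
by field; rewrite gt_eqF.
Qed.

Lemma slope0_neglog_factor_increasing :
  strictly_increasing `]0, +oo[ (slope0 neglog_factor).
Proof.
apply: (slope0_increasing d0 d1) => x x0.
have v0 := v_gt0 (ltW x0).
apply: mulr_gt0; first by rewrite exprn_even_gt0 //= lt_eqF.
by rewrite divr_gt0 ?exprn_gt0.
Qed.

Lemma slope0_neglog_factor_strictly_concave :
  strictly_concave `]0, +oo[ (slope0 neglog_factor).
Proof.
apply: (slope0_strictly_concave d0 d1 d2) => x x0.
have v0 := v_gt0 (ltW x0).
rewrite nmulr_rlt0; last by rewrite exprn_odd_lt0.
by rewrite divr_gt0 ?exprn_gt0 // mulr_gt0 // addr_gt0.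
Qed.

End Factor.

(** * Strict inequalities and infinite sums *)

Local Open Scope classical_set_scope.

(** For x < y the series of the differences s_i(y) - s_i(x) has positive terms,
    so its sum is at least its first term. *)
Lemma increasing_series (R : realType) (I : interval R) (s : nat -> R -> R)
    (S : R -> R) :
    (forall i, strictly_increasing I (s i)) ->
    {in I, forall x, series (s^~ x) @ \oo --> S x} ->
  strictly_increasing I S.
Proof.
move=> sincr sS x y xI yI xy.
have cS : (fun n => series (s^~ y) n - series (s^~ x) n) @ \oo --> S y - S x.
  by apply: cvgB; exact: sS.
rewrite -subr_gt0.
apply: (@lt_le_trans _ _ (s 0%N y - s 0%N x)).
  by rewrite subr_gt0 sincr.
rewrite -(cvg_lim _ cS) //.
apply: limr_ge; first by apply/cvg_ex; eexists; exact: cS.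
exists 1%N => // n /= n1.
rewrite /series /= -sumrB big_ltn //.
by rewrite lerDl sumr_ge0 // => i _; rewrite subr_ge0 ltW // sincr.
Qed.

(** As for monotonicity, the concavity defect of the sum is at least that of
    the first term. *)
Lemma strictly_concave_series (R : realType) (I : interval R)
    (s : nat -> R -> R) (S : R -> R) :
    (forall i, strictly_concave I (s i)) ->
    {in I, forall x, series (s^~ x) @ \oo --> S x} ->
  strictly_concave I S.
Proof.
move=> sconc sS x y t xI yI xy t01; set z := t * x + (1 - t) * y.
have zI : z \in I.
  have [/ltW t0 /ltW t1] := andP t01.
  have [/ltW le_xy|/ltW le_yx|e] := ltgtP x y; last by rewrite e eqxx in xy.
  - by apply: (@interval_is_interval R I x y xI yI); rewrite /z; nra.
  - by apply: (@interval_is_interval R I y x yI xI); rewrite /z; nra.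
have cS : (fun n => series (s^~ z) n -
   (t * series (s^~ x) n + (1 - t) * series (s^~ y) n)) @ \oo -->
   S z - (t * S x + (1 - t) * S y).
  by apply: cvgB; [exact: sS|apply: cvgD; apply: cvgMr; exact: sS].
rewrite -subr_gt0.
apply: (@lt_le_trans _ _ (s 0%N z - (t * s 0%N x + (1 - t) * s 0%N y))).
  by rewrite subr_gt0 sconc.
rewrite -(cvg_lim _ cS) //.
apply: limr_ge; first by apply/cvg_ex; eexists; exact: cS.
exists 1%N => // n /= n1.
rewrite /series /= !mulr_sumr -big_split /= -sumrB big_ltn //.
by rewrite lerDl sumr_ge0 // => i _; rewrite subr_ge0 ltW // sconc.
Qed.

(** * The q-Pochhammer symbol and the q-gamma function *)

Section Pochhammer.
Variables (R : realType) (q : R).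
Hypotheses (q0 : 0 < q) (q1 : q < 1).

Let P (a : R) (n : nat) := \prod_(i < n) (1 - a * q ^+ i).

Lemma qfactor_gt0 (a : R) i : 0 < a < 1 -> 0 < 1 - a * q ^+ i.
Proof.
move=> /andP[a0 a1]; rewrite subr_gt0 (le_lt_trans _ a1) // ger_pMr //.
by rewrite exprn_ile1 // ltW.
Qed.

Lemma qprod_gt0 (a : R) n : 0 < a < 1 -> 0 < P a n.
Proof. by move=> a01; apply: prodr_gt0 => i _; exact: qfactor_gt0. Qed.

(** This is 1 + w <= exp w for w = u / (1 - u), where 1 + w = 1 / (1 - u). *)
Lemma expR_le_1B (u : R) : u < 1 -> expR (- (u / (1 - u))) <= 1 - u.
Proof.
move=> u1; have v0 : 0 < 1 - u by rewrite subr_gt0.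
rewrite expRN -[leRHS]invrK lef_pV2 ?posrE ?invr_gt0 ?expR_gt0 //.
apply: le_trans (expR_ge1Dx _).
have -> // : 1 + u / (1 - u) = (1 - u)^-1.
by field; rewrite gt_eqF.
Qed.

(** A lower bound independent of n, which makes the infinite product positive:
    each factor is at least exp (- a q^i / (1 - a)), and the exponents form a
    geometric series. *)
Lemma qprod_ge (a : R) n : 0 < a < 1 ->
  expR (- (a / (1 - a) / (1 - q))) <= P a n.
Proof.
move=> a01; have [a0 a1] := andP a01.
apply: (@le_trans _ _ (\prod_(i < n) expR (- (a / (1 - a) * q ^+ i)))).
  rewrite -expR_sum ler_expR sumrN lerN2.
  rewrite -(big_mkord xpredT (fun i => a / (1 - a) * q ^+ i)).
  apply: (@geometric_le_lim _ n (a / (1 - a))) => //.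
    by rewrite divr_ge0 ?subr_ge0 // ltW.
  by rewrite gtr0_norm.
apply: ler_prod => i _; rewrite expR_ge0 /=.
have u1 : a * q ^+ i < 1 by rewrite -subr_gt0 qfactor_gt0.
apply: le_trans (expR_le_1B u1).
rewrite ler_expR lerN2 [leRHS]mulrAC ler_wpM2l //.
  by rewrite mulr_ge0 ?exprn_ge0 // ltW.
rewrite lef_pV2 ?posrE ?subr_gt0 //.
by rewrite lerB // ger_pMr // exprn_ile1 // ltW.
Qed.

Lemma is_cvg_qprod (a : R) : 0 < a < 1 -> cvgn (P a).
Proof.
move=> a01; apply: nonincreasing_is_cvgn.
  apply/nonincreasing_seqP => n; rewrite /P big_ord_recr /=.
  rewrite ger_pMr ?qprod_gt0 // gerBl mulr_ge0 ?exprn_ge0 ?ltW //.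
  by case/andP: a01.
by exists (expR (- (a / (1 - a) / (1 - q)))) => _ [n _ <-]; exact: qprod_ge.
Qed.

Lemma qpochhammer_gt0 (a : R) : 0 < a < 1 -> 0 < qpochhammer a q.
Proof.
move=> a01; apply: lt_le_trans (expR_gt0 (- (a / (1 - a) / (1 - q)))) _.
apply: limr_ge; first exact: is_cvg_qprod.
by exists 0%N => // n _; exact: qprod_ge.
Qed.

Lemma cvg_ln_qprod (a : R) : 0 < a < 1 ->
  series (fun i => ln (1 - a * q ^+ i)) @ \oo --> ln (qpochhammer a q).
Proof.
move=> a01.
have -> : series (fun i => ln (1 - a * q ^+ i)) = (@ln R) \o P a.
  apply/funext => n; rewrite /series /P /=; elim: n => [|n IH].
    by rewrite big_geq // big_ord0 ln1.
  rewrite big_nat_recr //= IH big_ord_recr /= lnM ?posrE ?qfactor_gt0 //.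
  exact: qprod_gt0.
apply: continuous_cvg; last exact: is_cvg_qprod.
exact/continuous_ln/qpochhammer_gt0.
Qed.

Lemma powR_itv01 (x : R) : 0 < x -> 0 < q `^ x < 1.
Proof.
move=> x0; rewrite powR_gt0 //= -(powRr0 q).
by rewrite /powR gt_eqF // ltr_expR ltr_nM2r // ln_lt0 // q0.
Qed.

Lemma qgamma_gt0 (x : R) : 0 < x -> 0 < qgamma q x.
Proof.
move=> x0; rewrite /qgamma mulr_gt0 ?divr_gt0 ?qpochhammer_gt0 ?q0 //.
- exact: powR_itv01.
- by rewrite powR_gt0 ?subr_gt0.
Qed.

(** The expansion of ln f as a sum of slopes.  Dividing the logarithm of the
    q-gamma function by x turns the logarithms of (q; q)_oo and of
    (q^(x+1); q)_oo, factor by factor, into slopes from the origin. *)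
Lemma cvg_slope_ln_qgamma (x : R) : 0 < x ->
  series (fun i => slope0 (neglog_factor (q ^+ i.+1) (ln q)) x) @ \oo -->
  ln (qgamma q (x + 1) `^ (1 / x)) + ln (1 - q).
Proof.
move=> x0; have x1 : 0 < x + 1 by rewrite addr_gt0.
have q01 : 0 < q < 1 by rewrite q0.
have qx := powR_itv01 x1.
have -> : ln (qgamma q (x + 1) `^ (1 / x)) + ln (1 - q) =
  x^-1 * (ln (qpochhammer q q) - ln (qpochhammer (q `^ (x + 1)) q)).
  rewrite ln_powR /qgamma lnM ?posrE ?powR_gt0 ?divr_gt0 ?qpochhammer_gt0
    ?subr_gt0 //.
  rewrite lnM ?posrE ?invr_gt0 ?qpochhammer_gt0 //.
  rewrite lnV ?posrE ?qpochhammer_gt0 // ln_powR.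
  by field; rewrite gt_eqF.
have -> : series (fun i => slope0 (neglog_factor (q ^+ i.+1) (ln q)) x) =
  (fun n => x^-1 * (series (fun i => ln (1 - q * q ^+ i)) n -
                   series (fun i => ln (1 - q `^ (x + 1) * q ^+ i)) n)).
  apply/funext => n; rewrite /series /= -sumrB mulr_sumr.
  apply: eq_bigr => i _; rewrite /slope0 /neglog_factor mulr0 expR0 mulr1.
  have -> : q `^ (x + 1) * q ^+ i = q ^+ i.+1 * expR (ln q * x).
    rewrite powRD ?gt_eqF ?implybT // powRr1 ?ltW // exprS.
    by rewrite {1}/powR gt_eqF // [ln q * x]mulrC; ring.
  by rewrite -exprS; ring.
by apply: cvgMr; apply: cvgB; exact: cvg_ln_qprod.
Qed.

End Pochhammer.

(** * Monotonicity and log-concavity *)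

Local Close Scope classical_set_scope.

Theorem theorem4 (R : realType) (q : R) (hq0 : 0 < q) (hq1 : q < 1) :
  strictly_log_concave `]0, +oo[ (fun x : R => qgamma q (x + 1) `^ (1 / x)) /\
  strictly_increasing `]0, +oo[ (fun x : R => qgamma q (x + 1) `^ (1 / x)).
Proof.
pose f x := qgamma q (x + 1) `^ (1 / x).
pose s i := slope0 (neglog_factor (q ^+ i.+1) (ln q)).
have itv0 (x : R) : (x \in `]0, +oo[) = (0 < x) by rewrite in_itv /= andbT.
have f_gt0 : {in `]0, +oo[, forall x, 0 < f x}.
  by move=> x; rewrite itv0 => x0; rewrite powR_gt0 ?qgamma_gt0 ?addr_gt0.
have sS : {in `]0, +oo[, forall x,
    (series (s^~ x) @ \oo --> ln (f x) + ln (1 - q))%classic}.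
  by move=> x; rewrite itv0 => x0; exact: cvg_slope_ln_qgamma.
have a_gt0 i : 0 < q ^+ i.+1 by rewrite exprn_gt0.
have a_lt1 i : q ^+ i.+1 < 1 by rewrite exprn_ilt1 // ltW.
have b_lt0 : ln q < 0 by rewrite ln_lt0 // hq0.
split; last first.
  have incr := increasing_series
    (fun i => slope0_neglog_factor_increasing (a_gt0 i) (a_lt1 i) b_lt0) sS.
  move=> x y x0 y0 xy; have := incr x y x0 y0 xy.
  by rewrite ltrD2r ltr_ln ?posrE ?f_gt0.
split=> //.
have conc := strictly_concave_series
  (fun i => slope0_neglog_factor_strictly_concave (a_gt0 i) (a_lt1 i) b_lt0) sS.
move=> x y t x0 y0 xy t01; have := conc x y t x0 y0 xy t01.
have shift (u v w c : R) : w + c - (t * (u + c) + (1 - t) * (v + c)) =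
    w - (t * u + (1 - t) * v) by ring.
by rewrite -subr_gt0 shift subr_gt0.
Qed.
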